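(* Fix a constant $\delta>0$. There exists $n_0=n_0(\delta)$ such that the following holds for all $n\ge n_0$, all $\lambda>0$, all $k\in\{1,\dots,n\}$, and all $1\le k'\le n^{1-\delta}$. Suppose $\min\{k,k'\}\ge\frac k\lambda\sqrt{\frac{k'}n}$ and $$\lambda\le\min\left\{n^{-\delta}\frac k2\sqrt{\frac{k'}n},\ \frac1{4e}\Big(\frac n{k'}\Big)^{1/2-\delta}\right\}.$$ For any $\beta$ satisfying $$0\le\beta\le\frac{\log2}{16}\,n^{-\delta}\min\left\{\frac k\lambda,\frac{n}{2e\lambda k'}\right\}$$ there exists $\ell$ satisfying $$\max\{n^\delta,2ek(k'/n)^{1-\delta}\}\le\ell\le\frac{k}{2\lambda}\sqrt{\frac{k'}n}\le\frac12\min\{k,k'\}$$ such that with probability at least $1-2^{-(\ell-2)/2}\ge1-2^{-(n^\delta-2)/2}$, $$D_{\beta,\ell}\ \ge\ \frac{\log2}{8}\min\left\{\frac{\log2}{8}\frac{k}{\beta\lambda},\ \frac k\lambda\sqrt{\frac{k'}n}\right\}-\log2 .$$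
   Context: $W$ is a $\mathrm{GOE}(n)$ matrix, i.e. an $n\times n$ symmetric random matrix with off-diagonal entries $\mathcal N(0,1/n)$ and diagonal entries $\mathcal N(0,2/n)$, independent up to symmetry; $x\in\{0,1\}^n$ is a fixed vector with exactly $k$ entries equal to $1$, and $Y=\frac{\lambda}{k}xx^\top+W$. Let $S_{k'}=\{v\in\{0,1\}^n:\|v\|_0=k'\}$ and $H(v)=-v^\top Yv$. For $\beta\ge0$ the Gibbs measure on $S_{k'}$ is $\mu_\beta(v)=e^{-\beta H(v)}/\sum_{u\in S_{k'}}e^{-\beta H(u)}$. For $\ell>0$ let $A=\{v\in S_{k'}:0\le\langle v,x\rangle<\ell\}$, $B=\{v\in S_{k'}:\ell\le\langle v,x\rangle\le2\ell\}$, and $D_{\beta,\ell}:=\log\mu_\beta(A)-\log\mu_\beta(B)$ (depth of the free energy well at correlation $\ell$). $\log$ is the natural logarithm, $e$ its base, and $k/(\beta\lambda)$ is read as $+\infty$ when $\beta=0$. *)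

(* Defs.v *)
From mathcomp Require Export all_boot all_order all_algebra.
From mathcomp Require Export all_classical all_reals all_analysis.
Set Implicit Arguments.
Unset Strict Implicit.
Unset Printing Implicit Defensive.
Import Order.TTheory GRing.Theory Num.Theory.
Import numFieldNormedType.Exports.
Local Open Scope ring_scope.

Section GOE.
Context {d : measure_display} {T : measurableType d} {R : realType}.
Variable P : probability T R.

Definition mutually_independent (I : finType) (D : {set I})
    (X : I -> {RV P >-> R}) : Prop :=
  forall (J : {set I}) (B : I -> set R), J \subset D ->
    (forall i, measurable (B i)) ->
    P (\bigcap_(i in [set` J]) (X i @^-1` B i))%classic =
    (\prod_(i in J) P (X i @^-1` B i)%classic)%E.

(* [normal_prob] takes the standard deviation, hence the square root. The two
   laws are compared on Borel sets only: on other sets their values as set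
   functions carry no meaning. *)
Definition has_normal_law (X : {RV P >-> R}) (mean var : R) : Prop :=
  forall B : set R, measurable B ->
    distribution P X B = normal_prob mean (Num.sqrt var) B.

Definition is_GOE (n : nat) (W : 'I_n -> 'I_n -> {RV P >-> R}) : Prop :=
  [/\ forall i j w, W i j w = W j i w,
      forall i j, i != j -> has_normal_law (W i j) 0 (1 / n%:R),
      forall i, has_normal_law (W i i) 0 (2 / n%:R)
    & mutually_independent [set ij : 'I_n * 'I_n | (ij.1 <= ij.2)%N]%SET
        (fun ij => W ij.1 ij.2)].

Definition random_mx (n : nat) (W : 'I_n -> 'I_n -> {RV P >-> R}) (w : T) :
  'M[R]_n := \matrix_(i, j) W i j w.

End GOE.

(* Vectors of {0,1}^n are boolean column vectors, so that sums over them are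
   finite sums; [vec01] embeds them into R^n. *)
Section Gibbs.
Context {R : realType} {n : nat}.
Implicit Types (v x : 'cV[bool]_n) (Y : 'M[R]_n).

Definition vec01 v : 'cV[R]_n := \col_i (v i 0)%:R.

Definition norm0 v : nat := #|[set i | v i 0]%SET|.

Definition slice (k' : nat) : {set 'cV[bool]_n} := [set v | norm0 v == k']%SET.

Definition dot v x : R := ((vec01 v)^T *m vec01 x) 0 0.

Definition spiked (lambda : R) (k : nat) x (W : 'M[R]_n) : 'M[R]_n :=
  (lambda / k%:R) *: (vec01 x *m (vec01 x)^T) + W.

Definition hamiltonian Y v : R := - ((vec01 v)^T *m Y *m vec01 v) 0 0.

Definition gibbs Y (k' : nat) (beta : R) v : R :=
  expR (- beta * hamiltonian Y v) /
  \sum_(u in slice k') expR (- beta * hamiltonian Y u).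

Definition gibbs_set Y (k' : nat) (beta : R) (A : {set 'cV[bool]_n}) : R :=
  \sum_(v in A) gibbs Y k' beta v.

Definition low_overlap x (k' : nat) (l : R) : {set 'cV[bool]_n} :=
  [set v in slice k' | 0 <= dot v x < l]%SET.

Definition mid_overlap x (k' : nat) (l : R) : {set 'cV[bool]_n} :=
  [set v in slice k' | l <= dot v x <= 2 * l]%SET.

(* Extended-real valued, with log 0 = -oo. *)
Definition well_depth Y x (k' : nat) (beta l : R) : \bar R :=
  (lne (gibbs_set Y k' beta (low_overlap x k' l))%:E
   - lne (gibbs_set Y k' beta (mid_overlap x k' l))%:E)%E.

End Gibbs.

(* Main.v *)
From HB Require Import structures.
Require Import Defs.
From mathcomp Require Import perm measurable_realfun ring lra zify.
Import Order.TTheory GRing.Theory Num.Theory.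
Import numFieldNormedType.Exports.
Local Open Scope ring_scope.

(** Let [nu] be the Gibbs measure of the pure noise model ([lambda = 0]). The
    law of a GOE matrix is invariant under simultaneous permutations of rows
    and columns, so the [nu]-weights of the vectors of the slice are
    exchangeable and each has mean [1/|slice|]. The expected [nu]-mass of
    overlaps at least [l] is thus a hypergeometric tail, at most [2^-l] as soon
    as [l >= 2 e k k' / n], and by Markov's inequality this mass is at most
    [2^(-l/2 - 1)] with probability at least [1 - 2^(-(l-2)/2)]. The spike only
    favours the vectors of [A], and it multiplies the weights of those of [B] by
    at most [exp (4 beta lambda l^2 / k)], so on that event the depth is at
    least [(ln 2 / 2) l - 4 beta lambda l^2 / k]. The choice
    [l = min ((ln 2 / 16) k / (beta lambda), (k / (2 lambda)) sqrt (k' / n))]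
    makes the second term at most half of the first. *)

(** * Overlaps in a slice *)

Section Slices.
Context {n : nat}.
Implicit Types (v x : 'cV[bool]_n) (A K : {set 'I_n}).

Definition supp v : {set 'I_n} := [set i | v i 0]%SET.

Lemma supp_inj : injective supp.
Proof.
move=> u v /setP uv; apply/matrixP => i j; rewrite ord1.
by have := uv i; rewrite !inE.
Qed.

Lemma suppK A : supp (\col_i (i \in A)) = A.
Proof. by apply/setP => i; rewrite inE mxE. Qed.

Lemma dotE (R : realType) v x : dot v x = #|supp v :&: supp x|%:R :> R.
Proof.
rewrite /dot mxE -sum1_card natr_sum [RHS]big_mkcond; apply: eq_bigr => i _.
by rewrite !mxE !inE; case: (v i 0); case: (x i 0); rewrite /= ?mul0r ?mulr0 ?mulr1.
Qed.

Lemma card_supp_imset (D : {set {set 'I_n}}) :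
  #|[set v | supp v \in D]%SET| = #|D|.
Proof.
rewrite -(card_imset _ supp_inj); apply: eq_card => A; apply/imsetP/idP.
  by case=> v; rewrite inE => vD ->.
by move=> AD; exists (\col_i (i \in A)); rewrite ?inE suppK.
Qed.

Lemma card_slice k : #|slice (n := n) k| = 'C(n, k).
Proof.
transitivity #|[set A : {set 'I_n} | #|A| == k]%SET|; last first.
  by rewrite card_draws card_ord.
by rewrite -card_supp_imset; apply: eq_card => v; rewrite !inE.
Qed.

Lemma card_bigcup_leq (I : finType) (T : finType) (D : {set I})
    (F : I -> {set T}) c :
  (forall i, i \in D -> #|F i| <= c)%N -> (#|\bigcup_(i in D) F i| <= #|D| * c)%N.
Proof.
move=> Fc; rewrite -sum_nat_const.
elim/big_ind2: _ => [|A a B b Aa Bb|i /Fc//]; first by rewrite cards0.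
by rewrite (leq_trans (leq_card_setU _ _))// leq_add.
Qed.

(** Such a support contains an [m]-subset of [supp x]. Choosing that subset first and then the other
    [k' - m] points anywhere outside it reaches every case, with overcounting. *)
Lemma card_large_overlap x k k' m : norm0 x = k ->
  (#|[set v in slice k' | m <= #|supp v :&: supp x|]%SET|
     <= 'C(k, m) * 'C(n - m, k' - m))%N.
Proof.
move=> xk; set K := supp x; have Kk : #|K| = k by [].
pose D := [set M : {set 'I_n} | M \subset K & #|M| == m]%SET.
pose F (M : {set 'I_n}) :=
  [set M :|: B | B in [set B : {set 'I_n} | B \subset ~: M & #|B| == (k' - m)%N]]%SET.
rewrite [X in (X <= _)%N](_ : _ =
    #|[set v | supp v \in [set A : {set 'I_n} | #|A| == k' & (m <= #|A :&: K|)%N]]%SET|);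
  last by apply: eq_card => v; rewrite !inE.
rewrite card_supp_imset.
have -> : 'C(k, m) = #|D| by rewrite cards_draws Kk.
apply: (@leq_trans #|\bigcup_(M in D) F M|); last first.
  apply: card_bigcup_leq => M; rewrite inE => /andP[_ /eqP Mm].
  by rewrite (leq_trans (leq_imset_card _ _))// cards_draws cardsCs finset.setCK card_ord Mm.
apply: subset_leq_card; apply/fintype.subsetP => A; rewrite inE => /andP[/eqP Ak mA].
have : (0 < #|[set M : {set 'I_n} | M \subset A :&: K & #|M| == m]%SET|)%N.
  by rewrite cards_draws bin_gt0.
case/card_gt0P => M; rewrite inE finset.subsetI => /andP[/andP[MA MK] Mm].
apply/bigcupP; exists M; first by rewrite inE MK.
apply/imsetP; exists (A :\: M)%SET.
  rewrite inE finset.subsetDr/= cardsD (finset.setIidPr MA) Ak.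
  by rewrite (eqP Mm).
apply/setP => i; rewrite !inE.
by case: (boolP (i \in M)) => //= /(fintype.subsetP MA) ->.
Qed.

End Slices.

(** The ratio of the two binomials is a product of factors [(k - i) / (n - i)], each at most
    [k / n]; clearing denominators keeps the induction in the naturals. *)
Lemma bin_sub_le n k m : (m <= k)%N -> (k <= n)%N ->
  ('C(n - m, k - m) * n ^ m <= 'C(n, k) * k ^ m)%N.
Proof.
elim: m => [|m IH] mk kn; first by rewrite !subn0.
have := IH (ltnW mk) kn.
have nm : (0 < n - m)%N by rewrite subn_gt0 (leq_trans mk).
have km : (0 < k - m)%N by rewrite subn_gt0.
have := mul_bin_diag (n - m) (k - m).-1.
rewrite prednK// -!subnS => E H.
rewrite -(leq_pmul2l nm) mulnA E !expnS.
apply: (@leq_trans (('C(n - m, k - m) * n ^ m) * (k * (n - m)))%N).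
  rewrite [X in (X <= _)%N](_ : _ = ('C(n - m, k - m) * n ^ m) * ((k - m) * n))%N.
    by rewrite leq_mul2l; apply/orP; right; nia.
  by lia.
rewrite [X in (_ <= X)%N](_ : _ = ('C(n, k) * k ^ m) * (k * (n - m)))%N; last by lia.
by rewrite leq_mul2r H orbT.
Qed.

Lemma ffact_le_expn n m : (n ^_ m <= n ^ m)%N.
Proof.
elim: m => [|m IH]; first by rewrite ffactn0.
by rewrite ffactnSr expnSr leq_mul// leq_subr.
Qed.

(** The bound [m! >= (m / e)^m], read off from a single term of the exponential series at [m]. *)
Lemma expn_le_fact (R : realType) m : m%:R ^+ m <= expR m%:R * m`!%:R :> R.
Proof.
case: m => [|m]; first by rewrite expr0 expR0 mul1r fact0.
rewrite -ler_pdivrMr ?ltr0n ?fact_gt0//.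
by apply: le_trans (expR_ge1Dxn m (ler0n R m.+1)); rewrite lerDr.
Qed.

(** The proportion is at most [C(k, m) (k' / n)^m <= (e k k' / (m n))^m], and the assumption on [m]
    makes the base at most [1 / 2]. *)
Lemma large_overlap_rare (R : realType) n (x : 'cV[bool]_n) k k' m :
  norm0 x = k -> (0 < k')%N -> (k' <= n)%N -> (0 < m)%N ->
  2 * expR 1 * k%:R * (k'%:R / n%:R) <= m%:R :> R ->
  #|[set v in slice k' | m <= #|supp v :&: supp x|]%SET|%N%:R * 2 ^+ m
    <= #|slice (n := n) k'|%:R :> R.
Proof.
move=> xk k'0 k'n m0 km; have n0 : (0 < n)%N := leq_trans k'0 k'n.
(* For [m > k'] no vector of the slice qualifies; [bin_sub_le] covers the other case. *)
have [mk'|k'm] := leqP m k'; last first.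
  rewrite [X in X * _](_ : _ = 0) ?mul0r//; apply/eqP.
  rewrite pnatr_eq0 cards_eq0 -finset.subset0; apply/fintype.subsetP => v.
  rewrite !inE => /andP[/eqP vk' mv].
  have := subset_leq_card (finset.subsetIl (supp v) (supp x)).
  by rewrite -/(norm0 v) vk' leqNgt (leq_trans k'm).
rewrite card_slice.
apply: (@le_trans _ _ (('C(k, m) * 'C(n - m, k' - m))%:R * 2 ^+ m)).
  by rewrite ler_wpM2r ?exprn_ge0// ler_nat card_large_overlap.
have nm0 : 0 < n%:R ^+ m * m%:R ^+ m :> R by rewrite mulr_gt0 ?exprn_gt0 ?ltr0n.
rewrite -(ler_pM2r nm0).
have Ckm : 'C(k, m)%:R * m`!%:R <= k%:R ^+ m :> R.
  by rewrite -natrM -natrX ler_nat bin_ffact; exact: ffact_le_expn.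
have Cnm : 'C(n - m, k' - m)%:R * n%:R ^+ m <= 'C(n, k')%:R * k'%:R ^+ m :> R.
  by rewrite -!natrX -!natrM ler_nat bin_sub_le.
have mm := expn_le_fact R m.
have e0 := expR_ge0 (m%:R : R).
apply: (@le_trans _ _ ('C(n, k')%:R * k'%:R ^+ m * k%:R ^+ m * expR m%:R * 2 ^+ m)).
  rewrite natrM.
  rewrite [X in X <= _](_ : _ = ('C(n - m, k' - m)%:R * n%:R ^+ m) * ('C(k, m)%:R * m%:R ^+ m) * 2 ^+ m); last by ring.
  rewrite ler_wpM2r ?exprn_ge0// -[X in _ <= X]mulrA ler_pM ?mulr_ge0 ?exprn_ge0//.
  apply: (@le_trans _ _ ('C(k, m)%:R * (expR m%:R * m`!%:R))).
    by rewrite ler_wpM2l.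
  by rewrite mulrCA mulrC ler_wpM2r.
have -> : expR (m%:R : R) = expR 1 ^+ m by rewrite -expRM_natl mulr1.
rewrite -!mulrA ler_wpM2l// -!exprMn.
apply: lerXn2r; rewrite ?nnegrE ?mulr_ge0 ?expR_ge0//.
by rewrite -ler_pdivrMl ?ltr0n//; apply: le_trans km; rewrite le_eqVlt; apply/orP; left; apply/eqP; ring.
Qed.

(** * Permutation invariance of the GOE *)

Section TupleMeasure.
Context {d} {U : measurableType d} {N : nat}.

Definition box (B : 'I_N -> set U) : set (N.-tuple U) :=
  [set t | forall i, B i (tnth t i)]%classic.

(** A pi-system generating the product sigma-algebra, on which independence computes
    probabilities. *)
Definition boxes : set (set (N.-tuple U)) :=
  [set A | exists2 B, (forall i, measurable (B i)) & A = box B]%classic.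

Lemma measurable_box (B : 'I_N -> set U) :
  (forall i, measurable (B i)) -> measurable (box B).
Proof.
move=> mB.
rewrite (_ : box B = \big[setI/setT]_(i < N) ((@tnth N U ^~ i) @^-1` B i))%classic.
  apply: bigsetI_measurable => i _.
  by rewrite -[X in measurable X]setTI; exact: measurable_tnth.
by rewrite -bigcap_seq; apply/seteqP; split=> t /= tB i; [move=> _|]; apply: tB;
  rewrite //= mem_index_enum.
Qed.

Lemma measurable_tupleE : @measurable _ (N.-tuple U) = (<<s boxes >>)%classic.
Proof.
apply/seteqP; split.
- apply: smallest_sub; first exact: smallest_sigma_algebra.
  rewrite -bigcup_seq => A [i /= _ [B mB <-]]; apply: sub_sigma_algebra.
  exists (fun j => if j == i then B else setT) => [j|]; first by case: ifP.
  apply/seteqP; split=> t /=; first by move=> [_ Bt] j; case: eqP => // ->.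
  by move=> /(_ i); rewrite eqxx.
- apply: smallest_sub; first exact: sigma_algebra_measurable.
  by move=> _ [B mB ->]; exact: measurable_box.
Qed.

(** [boxes] is closed under intersection, so agreement there propagates to the generated
    sigma-algebra; as [m1] is finite, the constant sequence [setT] serves as exhaustion. *)
Lemma measure_tuple_unique (R : realType)
    (m1 m2 : {measure set (N.-tuple U) -> \bar R}) :
  (m1 setT < +oo)%E ->
  (forall B, (forall i, measurable (B i)) -> m1 (box B) = m2 (box B)) ->
  forall A, measurable A -> m1 A = m2 A.
Proof.
move=> m1T m12 A mA.
apply: (@measure_unique _ R _ boxes (fun=> setT)) => //.
- exact: measurable_tupleE.
- move=> _ _ [B mB ->] [C mC ->]; exists (fun i => B i `&` C i)%classic.
    by move=> i; exact: measurableI.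
  by apply/seteqP; split=> t /= => [[Bt Ct] i|BCt]; [|split=> i; case: (BCt i)].
- by move=> _; exists (fun=> setT) => //; apply/seteqP; split.
- by apply/seteqP; split=> // t _; exists 0%N.
- by move=> _ [B mB ->]; exact: m12.
Qed.

End TupleMeasure.

Section Law.
Context {R : realType} {n : nat} {d : measure_display} {T : measurableType d}
  {P : probability T R} {W : 'I_n -> 'I_n -> {RV P >-> R}}.
Hypothesis GOE : is_GOE W.
Implicit Types (s : {perm 'I_n}) (p : 'I_n * 'I_n).

Let D := [set ij : 'I_n * 'I_n | (ij.1 <= ij.2)%N]%SET.
Let var p : R := (if p.1 == p.2 then 2 else 1) / n%:R.
Let sort p := if (p.1 <= p.2)%N then p else (p.2, p.1).
(** By symmetry of [W], the entry at [(s i, s j)] is the one at [act s (i, j)], so [act s] is the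
    permutation of the independent entries induced by [s]. *)
Let act s p := sort (s p.1, s p.2).

Lemma GOE_law p (B : set R) : measurable B ->
  P (W p.1 p.2 @^-1` B)%classic = normal_prob 0 (Num.sqrt (var p)) B.
Proof.
case: GOE => _ offdiag diag _; rewrite /var; case: eqP => [<-|/eqP p12].
  exact: diag.
exact: offdiag.
Qed.

Let actK s p : p \in D -> act (s^-1)%g (act s p) = p.
Proof.
rewrite inE /act /sort; case: p => i j /= ij.
have [sij|sji] := leqP (s i) (s j); rewrite /= !permK ?ij//.
(* The pair comes back as [(j, i)], which sorting leaves in place only when [j <= i], that is on the
   diagonal. *)
case: leqP => //= ji; have /anti_leq/val_inj -> // : (i <= j <= i)%N by rewrite ij.
Qed.

Let act_in s p : act s p \in D.
Proof. by rewrite inE /act /sort /=; have [|/ltnW] := leqP (s p.1) (s p.2). Qed.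

(** The right-hand side does not involve [s]: this is the invariance of the law, tested on boxes.
    Mirror positions constrain the same variable, hence the intersections. *)
Lemma GOE_box s (B : 'I_n * 'I_n -> set R) : (forall p, measurable (B p)) ->
  P [set w | forall p, B p (W (s p.1) (s p.2) w)]%classic =
  (\prod_(p in D) normal_prob 0 (Num.sqrt (var p)) (B p `&` B (p.2, p.1))%classic)%E.
Proof.
move=> mB; have [Wsym _ _ ind] := GOE.
(* [C p] gathers the two constraints that fall on the entry at [p]: those at the preimages under [s]
   of [p] and of its mirror image. *)
pose C p := (B (s^-1 p.1, s^-1 p.2)%g `&` B (s^-1 p.2, s^-1 p.1)%g)%classic.
have mC p : measurable (C p) by exact: measurableI.
have -> : [set w | forall p, B p (W (s p.1) (s p.2) w)]%classic =
    (\bigcap_(p in [set` D]) (W p.1 p.2 @^-1` C p))%classic.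
  apply/seteqP; split=> w /= Bw.
    move=> p pD; split=> /=.
      by have := Bw (s^-1 p.1, s^-1 p.2)%g; rewrite /= !permKV.
    by have := Bw (s^-1 p.2, s^-1 p.1)%g; rewrite /= !permKV Wsym.
  move=> [i j] /=; have [sij|/ltnW sji] := leqP (s i) (s j).
    have [] := Bw (s i, s j); first by rewrite /= inE.
    by rewrite /= !permK.
  have [] := Bw (s j, s i); first by rewrite /= inE.
  by rewrite /= !permK Wsym.
rewrite (ind D C)//.
rewrite (eq_bigr (fun p => normal_prob 0 (Num.sqrt (var p)) (C p))); last first.
  by move=> p _; apply: GOE_law; exact: mC.
(* [act s] is a bijection of [D]. It preserves the variance, since the diagonal goes to the
   diagonal, and the pair of constraints up to order. *)
rewrite (reindex_onto (act s) (act (s^-1)%g)) /=; last first.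
  by move=> p pD; have := actK (s^-1)%g p pD; rewrite invgK.
apply: eq_big => p.
  rewrite act_in /=; apply/eqP/idP => [<-|]; first exact: act_in.
  exact: actK.
move=> _.
have -> : var (act s p) = var p.
  rewrite /var /act /sort /=.
  by have [_|_] := leqP (s p.1) (s p.2); rewrite /= 1?eq_sym (inj_eq perm_inj) 1?eq_sym.
rewrite /C /act /sort /=; have [_|_] := leqP (s p.1) (s p.2); rewrite /= !permK -?surjective_pairing//.
by rewrite setIC.
Qed.

Definition mx_of_tuple (t : #|{: 'I_n * 'I_n}|.-tuple R) : 'M[R]_n :=
  \matrix_(i, j) tnth t (enum_rank (i, j)).

Let vals s w : #|{: 'I_n * 'I_n}|.-tuple R :=
  [tuple W (s (enum_val i).1) (s (enum_val i).2) w | i < #|{: 'I_n * 'I_n}|].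

Let measurable_vals s : measurable_fun setT (vals s).
Proof.
apply/measurable_fun_tnthP => i.
rewrite (_ : _ \o _ = W (s (enum_val i).1) (s (enum_val i).2)).
  exact: measurable_funP.
by apply/funext => w; rewrite /= tnth_mktuple.
Qed.

HB.instance Definition _ s := isMeasurableFun.Build _ _ _ _ _ (measurable_vals s).

Let vals_law s A : measurable A ->
  distribution P (vals s) A = distribution P (vals 1%g) A.
Proof.
apply: (@measure_tuple_unique _ _ _ _ (distribution P (vals s)) (distribution P (vals 1%g))).
  by rewrite /= /distribution /pushforward preimage_setT probability_setT ltry.
move=> B mB; rewrite /distribution /pushforward.
have box_vals s' : (vals s' @^-1` box B)%classic =
    [set w | forall p, B (enum_rank p) (W (s' p.1) (s' p.2) w)]%classic.
  apply/seteqP; split=> w /= Bw.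
    by move=> p; have := Bw (enum_rank p); rewrite tnth_mktuple enum_rankK.
  by move=> i; have := Bw (enum_val i); rewrite tnth_mktuple enum_valK.
have law s' := GOE_box s' (fun p => B (enum_rank p)) (fun p => mB _).
by transitivity (P (vals s @^-1` box B)%classic); rewrite // box_vals law -(law 1%g) -box_vals.
Qed.

(** Both sides are integrals against the law of the flattened entries, for [s] and for the identity,
    and [vals_law] identifies these laws. *)
Lemma GOE_perm_integral s (f : 'M[R]_n -> R) :
  measurable_fun setT (f \o mx_of_tuple) -> (forall M, 0 <= f M) ->
  (\int[P]_w (f (\matrix_(i, j) W (s i) (s j) w))%:E =
   \int[P]_w (f (random_mx W w))%:E)%E.
Proof.
move=> mf f0.
have mf' : measurable_fun setT (EFin \o (f \o mx_of_tuple)).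
  exact/measurable_EFinP.
have E s' : (\int[P]_w (f (\matrix_(i, j) W (s' i) (s' j) w))%:E =
    \int[distribution P (vals s')]_t (f (mx_of_tuple t))%:E)%E.
  rewrite (ge0_integral_pushforward (measurable_vals s'))//; last first.
    by move=> t _; rewrite /= lee_fin.
  rewrite preimage_setT; apply: eq_integral => w _ /=; congr (f _)%:E.
  by apply/matrixP => i j; rewrite !mxE tnth_mktuple enum_rankK.
rewrite E (_ : random_mx W = fun w => \matrix_(i, j) W ((1%g : {perm 'I_n}) i) ((1%g : {perm 'I_n}) j) w).
  rewrite E; apply: eq_measure_integral => A mA _; exact: vals_law.
by apply/funext => w; apply/matrixP => i j; rewrite !mxE !perm1.
Qed.

End Law.

(** * Measurability and exchangeability of the Gibbs weights *)

Lemma measurable_gibbs (R : realType) d (T : measurableType d) n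
    (M : T -> 'M[R]_n) k beta v :
  (forall i j, measurable_fun setT (fun w => M w i j)) ->
  measurable_fun setT (fun w => gibbs (M w) k beta v).
Proof.
move=> mM.
have mexp u : measurable_fun setT (fun w => expR (- beta * hamiltonian (M w) u)).
  apply: measurableT_comp; first exact: measurable_expR.
  apply: measurable_funM; first exact: measurable_cst.
  rewrite /hamiltonian; apply: (measurableT_comp (@oppr_measurable R setT)).
  under eq_fun do rewrite mxE.
  apply: measurable_sum => i; apply: measurable_funM; last exact: measurable_cst.
  under eq_fun do rewrite mxE.
  by apply: measurable_sum => j; apply: measurable_funM.
rewrite (_ : (fun w => _) = fun w => expR (- beta * hamiltonian (M w) v) *
    (\sum_(u in slice k) expR (- beta * hamiltonian (M w) u)) `^ (-1)); last first.
  apply/funext => w; rewrite powR_inv1//; apply: sumr_ge0 => u _; exact: expR_ge0.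
apply: measurable_funM => //.
apply: (measurableT_comp (measurable_powR (-1))).
under eq_fun do rewrite -big_enum.
exact: measurable_sum.
Qed.

Section GibbsPerm.
Context {R : realType} {n : nat}.
Implicit Types (u v : 'cV[bool]_n) (s : {perm 'I_n}) (M : 'M[R]_n).

Definition perm_vec s v : 'cV[bool]_n := \col_i v (s i) 0.

Definition perm_mx2 s M : 'M[R]_n := \matrix_(i, j) M (s i) (s j).

Lemma perm_vecK s : cancel (perm_vec s) (perm_vec s^-1%g).
Proof. by move=> v; apply/colP => i; rewrite !mxE permKV. Qed.

Lemma norm0_perm s v : norm0 (perm_vec s v) = norm0 v.
Proof.
rewrite /norm0 -[RHS](card_imset _ (@perm_inj _ s^-1%g)).
apply: eq_card => i; rewrite inE mxE; apply/idP/imsetP => [vs|[j]].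
  by exists (s i); rewrite ?inE// permK.
by rewrite inE => vj ->; rewrite permKV.
Qed.

Lemma slice_perm s k v : (perm_vec s v \in slice k) = (v \in slice k).
Proof. by rewrite !inE norm0_perm. Qed.

Lemma hamiltonian_perm s M v :
  hamiltonian (perm_mx2 s M) (perm_vec s v) = hamiltonian M v.
Proof.
rewrite /hamiltonian; congr (- _); rewrite !mxE.
rewrite [RHS](reindex_inj (@perm_inj _ s)); apply: eq_bigr => j _.
rewrite !mxE; congr (_ * _).
rewrite [RHS](reindex_inj (@perm_inj _ s)); apply: eq_bigr => i _.
by rewrite !mxE.
Qed.

Lemma gibbs_perm s M k beta v :
  gibbs (perm_mx2 s M) k beta (perm_vec s v) = gibbs M k beta v.
Proof.
rewrite /gibbs hamiltonian_perm; congr (_ / _).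
rewrite (reindex_inj (can_inj (perm_vecK s))).
apply: eq_big => u; first exact: slice_perm.
by rewrite hamiltonian_perm.
Qed.

(** Two boolean words of the same length with the same number of ones are rearrangements of each
    other. *)
Lemma slice_transitive k u v : u \in slice k -> v \in slice k ->
  exists s, v = perm_vec s u.
Proof.
rewrite !inE => /eqP uk /eqP vk.
pose t (w : 'cV[bool]_n) : n.-tuple bool := [tuple w i 0 | i < n].
have count_t (w : 'cV[bool]_n) (b : bool) : count_mem b (t w) = #|[pred i | w i 0 == b]|.
  by rewrite /= count_map -size_filter cardE; congr size; rewrite enumT; apply: eq_filter.
have : perm_eq (t v) (t u).
  apply/allP => b _ /=; rewrite !count_t.
  have cardt (w : 'cV[bool]_n) : norm0 w = k -> #|[pred i | w i 0 == true]| = k.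
    by move=> <-; apply: eq_card => i; rewrite !inE eqb_id.
  case: b; first by rewrite !cardt.
  have cardf (w : 'cV[bool]_n) : #|[pred i | w i 0 == false]| = (n - #|[pred i | w i 0%R == true]|)%N.
    rewrite -[X in (X - _)%N]card_ord -(cardC [pred i | w i 0 == true]) addKn.
    apply: eq_card => i; rewrite !inE.
    by case: (w i 0).
  by rewrite !cardf !cardt.
case/tuple_permP => s E; exists s; apply/colP => i; rewrite mxE.
have := congr1 (nth false ^~ i) E.
by rewrite -!tnth_nth !tnth_mktuple.
Qed.

Lemma gibbs_ge0 M k beta v : 0 <= gibbs M k beta v.
Proof.
by apply: divr_ge0; rewrite ?expR_ge0//; apply: sumr_ge0 => u _; exact: expR_ge0.
Qed.

Lemma partition_gt0 M k beta : slice (n := n) k != finset.set0 ->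
  0 < \sum_(u in slice k) expR (- beta * hamiltonian M u).
Proof.
case/set0Pn => v vk; rewrite (bigD1 v)//= ltr_pwDl ?expR_gt0//.
by apply: sumr_ge0 => u _; exact: expR_ge0.
Qed.

Lemma gibbs_slice M k beta : slice (n := n) k != finset.set0 ->
  gibbs_set M k beta (slice k) = 1.
Proof.
move=> k0; rewrite /gibbs_set /gibbs -mulr_suml divff// gt_eqF//.
exact: partition_gt0.
Qed.

End GibbsPerm.

(** Permutation invariance together with [slice_transitive] makes all mean weights equal, and they
    add up to [1] over the slice. *)
Lemma GOE_gibbs_set_mean (R : realType) n d (T : measurableType d)
    (P : probability T R) (W : 'I_n -> 'I_n -> {RV P >-> R}) k beta
    (U : {set 'cV[bool]_n}) :
  is_GOE W -> U \subset slice k -> slice (n := n) k != finset.set0 ->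
  (\int[P]_w (gibbs_set (random_mx W w) k beta U)%:E =
   (#|U|%:R / #|slice (n := n) k|%:R)%:E)%E.
Proof.
move=> GOE Uk k0.
have mW v : measurable_fun setT (fun w => (gibbs (random_mx W w) k beta v)%:E).
  apply/measurable_EFinP; apply: measurable_gibbs => i j.
  by under eq_fun do rewrite mxE; exact: measurable_funP.
have [v0 v0k] := set0Pn _ k0.
pose E v := (\int[P]_w (gibbs (random_mx W w) k beta v)%:E)%E.
have Ev v : v \in slice k -> E v = E v0.
  move=> vk; have [s ->] := slice_transitive _ _ _ v0k vk.
  apply: (etrans (esym (GOE_perm_integral GOE s
      (fun M => gibbs M k beta (perm_vec s v0)) _ _))).
  - apply: measurable_gibbs => i j.
    by under eq_fun do rewrite mxE; exact: measurable_tnth.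
  - by move=> M; exact: gibbs_ge0.
  - apply: eq_integral => w _; rewrite -(gibbs_perm s (random_mx W w)).
    have -> // : \matrix_(i, j) W (s i) (s j) w = perm_mx2 s (random_mx W w).
    by apply/matrixP => i j; rewrite !mxE.
(* Used for the whole slice, to determine [E v0], and then for [U]. *)
have ES (V : {set 'cV[bool]_n}) : V \subset slice k ->
    (\int[P]_w (gibbs_set (random_mx W w) k beta V)%:E = E v0 *+ #|V|)%E.
  move=> Vk; rewrite /gibbs_set.
  under eq_integral => w _ do rewrite -big_enum -sumEFin.
  rewrite ge0_integral_sum//; last by move=> v w _; rewrite lee_fin gibbs_ge0.
  rewrite big_enum/= (eq_bigr (fun=> E v0)) => [|v vV].
    by rewrite big_const; elim: #|V| => [|m IH]; rewrite ?muleS ?iterS ?IH.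
  by apply: Ev; exact: (fintype.subsetP Vk).
have := ES _ (subxx (slice k)).
under eq_integral do rewrite gibbs_slice//.
rewrite integral_cst//= probability_setT mule1 => Ev0.
rewrite ES//.
have c0 : #|slice (n := n) k|%:R != 0 :> R by rewrite pnatr_eq0 -lt0n card_gt0.
have : E v0 = (#|slice (n := n) k|%:R^-1)%:E.
  (* [E v0] is a priori an extended real; an infinite value would contradict the total mass [1]. *)
  move: Ev0; rewrite -mule_natl; case: (E v0) => [r||].
  - by rewrite -EFinM => -[] e; congr _%:E; apply: (mulfI c0); rewrite -e divff.
  - by rewrite gt0_muley // lte_fin ltr0n card_gt0.
  - by rewrite gt0_muleNy // lte_fin ltr0n card_gt0.
by move=> ->; rewrite -mule_natl -EFinM.
Qed.

(** * Depth of the well *)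

Lemma hamiltonian_spiked (R : realType) n lambda k (x v : 'cV[bool]_n) (M : 'M[R]_n) :
  hamiltonian (spiked lambda k x M) v = hamiltonian M v - lambda / k%:R * dot v x ^+ 2.
Proof.
rewrite /hamiltonian /spiked mulmxDr mulmxDl mxE opprD addrC; congr (_ - _).
rewrite -scalemxAr -scalemxAl mxE; congr (_ * _).
rewrite mulmxA -[in LHS](mulmxA ((vec01 v)^T *m vec01 x)) [LHS]mxE big_ord1 expr2; congr (_ * _).
by rewrite -[vec01 v in LHS]trmxK -trmx_mul mxE.
Qed.

Lemma gibbs_set_ge0 (R : realType) n (M : 'M[R]_n) k beta U :
  0 <= gibbs_set M k beta U.
Proof. by apply: sumr_ge0 => v _; exact: gibbs_ge0. Qed.

Lemma gibbs_setE (R : realType) n (M : 'M[R]_n) k beta U :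
  gibbs_set M k beta U = (\sum_(v in U) expR (- beta * hamiltonian M v)) /
    \sum_(v in slice k) expR (- beta * hamiltonian M v).
Proof. by rewrite /gibbs_set -mulr_suml. Qed.

(** Removes the logarithms; for [b = 0] the convention [lne 0 = -oo] makes both sides true. *)
Lemma lne_diff_ge (R : realType) (a b c : R) : 0 < a -> 0 <= b ->
  (c%:E <= lne a%:E - lne b%:E)%E = (expR c * b <= a).
Proof.
move=> a0; rewrite le_eqVlt => /orP[/eqP <-|b0].
  by rewrite mulr0 (ltW a0) lne_EFin// le0_lneNy//= leey.
rewrite !lne_EFin// -EFinB lee_fin lerBrDr.
by rewrite -[LHS]ler_expR expRD !lnK.
Qed.

(** The complement of [low_overlap] in the slice. It contains [mid_overlap], and without the cut-off
    [2 l] its mean mass is a hypergeometric tail. *)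
Definition high_overlap {R : realType} {n} (x : 'cV[bool]_n) k' (l : R) :
  {set 'cV[bool]_n} := [set v in slice k' | l <= dot v x]%SET.

Section Depth.
Context {R : realType} {n : nat} {x : 'cV[bool]_n}.
Context {lambda beta l : R} {k k' : nat}.
Hypotheses (lambda_gt0 : 0 < lambda) (beta_ge0 : 0 <= beta).

(** The deterministic half of the argument: [M] is a fixed noise matrix whose high overlaps carry
    little mass, and all sums are compared with the noise weights [wt]. *)
Lemma spike_bound M :
  0 <= l -> slice (n := n) k' != finset.set0 ->
  gibbs_set M k' beta (high_overlap x k' l) <= 2 `^ (- (l / 2) - 1) ->
  expR (ln 2 / 2 * l - 4 * beta * lambda * l ^+ 2 / k%:R) *
    gibbs_set (spiked lambda k x M) k' beta (mid_overlap x k' l) <=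
  gibbs_set (spiked lambda k x M) k' beta (low_overlap x k' l).
Proof.
move=> l0 S0.
set Y := spiked lambda k x M.
set c := 4 * beta * lambda * l ^+ 2 / k%:R.
set Z := \sum_(v in slice k') expR (- beta * hamiltonian M v).
have Z0 : 0 < Z by exact: partition_gt0.
have ZY0 : 0 < \sum_(v in slice k') expR (- beta * hamiltonian Y v).
  exact: partition_gt0.
have dot0 v : 0 <= dot v x :> R by rewrite dotE ler0n.
have lk : 0 <= lambda / k%:R by rewrite divr_ge0// ltW.
pose wt v := expR (- beta * hamiltonian M v).
rewrite gibbs_setE -/Z ler_pdivrMr// => high.
have split : \sum_(v in low_overlap x k' l) wt v =
    Z - \sum_(v in high_overlap x k' l) wt v.
  apply/eqP; rewrite eq_sym subr_eq addrC; apply/eqP.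
  rewrite /Z (bigID [pred v | l <= dot v x])/=; congr (_ + _); apply: eq_bigl => v.
    by rewrite [in RHS]inE.
  by rewrite [in RHS]inE dot0 -ltNge.
have low : \sum_(v in low_overlap x k' l) wt v <=
    \sum_(v in low_overlap x k' l) expR (- beta * hamiltonian Y v).
  apply: ler_sum => v _; rewrite ler_expR hamiltonian_spiked mulrBr lerDl.
  by rewrite mulNr opprK; apply: mulr_ge0 => //; apply: mulr_ge0 => //; exact: exprn_ge0.
have mid : \sum_(v in mid_overlap x k' l) expR (- beta * hamiltonian Y v) <=
    expR c * \sum_(v in high_overlap x k' l) wt v.
  rewrite mulr_sumr; apply: (@le_trans _ _ (\sum_(v in mid_overlap x k' l) expR c * wt v)).
    apply: ler_sum => v; rewrite inE => /and3P[_ _ v2l].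
    rewrite -expRD ler_expR hamiltonian_spiked mulrBr addrC lerD2r mulNr opprK.
    (* The upper cut-off [2 l] of the middle range bounds the exponent of the spike by [c]. *)
    have : dot v x ^+ 2 <= (2 * l) ^+ 2 by apply: lerXn2r; rewrite ?nnegrE// mulr_ge0.
    move=> /(ler_wpM2l lk)/(ler_wpM2l beta_ge0)/le_trans; apply.
    by rewrite le_eqVlt /c; apply/orP; left; apply/eqP; ring.
  rewrite [X in _ <= X](bigID (mem (mid_overlap x k' l)))/=.
  rewrite [X in _ <= X + _](_ : _ = \sum_(v in mid_overlap x k' l) expR c * wt v); last first.
    by apply: eq_bigl => v; rewrite !inE; case: (_ == _) => //=; case: (l <= _).
  by rewrite lerDl; apply: sumr_ge0 => v _; rewrite mulr_ge0// expR_ge0.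
rewrite !gibbs_setE mulrA ler_pM2r ?invr_gt0//.
apply: (@le_trans _ _ (expR (ln 2 / 2 * l - c) * (expR c * (2 `^ (- (l / 2) - 1) * Z)))).
  by rewrite ler_wpM2l ?expR_ge0// (le_trans mid)// ler_wpM2l ?expR_ge0.
apply: le_trans low; rewrite split.
(* Since [l >= 0], at least half of [Z] remains on the low overlaps. *)
have half : 2 `^ (- (l / 2) - 1) <= 2^-1 :> R.
  rewrite -[leRHS]powR_inv1//; apply: ler_powR; first by rewrite ler1n.
  by move: l0; lra.
(* The [- 1] in the threshold serves here: the exponential factors leave exactly [1 / 2]. *)
have -> : expR (ln 2 / 2 * l - c) * (expR c * (2 `^ (- (l / 2) - 1) * Z)) = Z / 2.
  rewrite mulrA -expRD subrK mulrA /powR pnatr_eq0/= -expRD.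
  rewrite (_ : ln 2 / 2 * l + (- (l / 2) - 1) * ln 2 = - ln 2); last by field.
  by rewrite expRN lnK ?posrE// mulrC.
have : 2 `^ (- (l / 2) - 1) * Z <= 2^-1 * Z by rewrite ler_wpM2r// ltW.
move: high; rewrite -/wt; lra.
Qed.

End Depth.

(** * Markov's inequality and the probability of the depth bound *)

Lemma markov_le d (T : measurableType d) (R : realType) (P : probability T R)
    (f : T -> R) (q b : R) : measurable_fun setT f -> (forall w, 0 <= f w) -> 0 < q ->
  (\int[P]_w (f w)%:E <= b%:E)%E ->
  ((1 - b / q)%:E <= P [set w | (f w <= q)%R]%classic)%E.
Proof.
move=> mf f0 q0 fb.
have mE : measurable [set w | (q <= f w)%R]%classic.
  by rewrite -[X in measurable X]setTI; apply: measurable_fun_le => //; exact: measurable_cst.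
have mG : measurable [set w | (f w <= q)%R]%classic.
  by rewrite -[X in measurable X]setTI; apply: measurable_fun_le => //; exact: measurable_cst.
have mfE : measurable_fun setT (EFin \o f) by exact/measurable_EFinP.
have PE : (P [set w | (q <= f w)%R]%classic <= (b / q)%:E)%E.
  have := @le_integral_comp_abse _ T R P _ measurableT _ q id (@measurable_id _ _ _)
     (fun r r0 => r0) (fun _ _ _ _ H => H) mfE q0.
  rewrite setTI => H.
  rewrite -[leLHS]mul1e -(@divff _ q) ?gt_eqF// mulrC EFinM -muleA mulrC EFinM.
  apply: lee_wpmul2l; first by rewrite lee_fin invr_ge0 ltW.
  apply: le_trans fb; apply: le_trans (le_trans H _).
    apply: lee_wpmul2l; first by rewrite lee_fin ltW.
    rewrite (_ : [set w | (q <= f w)%R]%classic = [set w | (q%:E <= `|(EFin \o f) w|)%E]%classic)//.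
    by apply/seteqP; split=> w /=; rewrite lee_fin ger0_norm.
  by rewrite le_eqVlt; apply/orP; left; apply/eqP; apply: eq_integral => w _; rewrite /= ger0_norm.
(* The two events may overlap where [f w = q], so subadditivity of [P] replaces passing to the
   complement. *)
have : (1%E <= P [set w | (f w <= q)%R]%classic + P [set w | (q <= f w)%R]%classic)%E.
  rewrite -(probability_setT P) -(_ : [set w | (f w <= q)%R] `|` [set w | (q <= f w)%R] = setT)%classic.
    exact: measureU2.
  by apply/seteqP; split=> // w _ /=; apply/orP; exact: le_total.
move=> H; rewrite EFinB leeBlDr//; apply: (le_trans H); exact: leeD2l.
Qed.

(** Overlaps are integers, so the level [l] can be rounded up to the least integer [m >= l], and the
    counting bound [2^-m] is at most [2^-l]. *)
Lemma high_overlap_mean_le (R : realType) n (x : 'cV[bool]_n) k k' (l : R) :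
  norm0 x = k -> (0 < k')%N -> (k' <= n)%N -> 0 < l ->
  2 * expR 1 * k%:R * (k'%:R / n%:R) <= l ->
  #|high_overlap x k' l|%N%:R / #|slice (n := n) k'|%:R <= 2 `^ (- l) :> R.
Proof.
move=> xk k'0 k'n l0 kl.
have exm : exists m, l <= m%:R.
  by exists (Num.bound l); apply/ltW/archi_boundP/ltW.
have [m lm mmin] := ex_minnP exm.
have m0 : (0 < m)%N by rewrite -(ltr0n R) (lt_le_trans l0).
have S0 : 0 < #|slice (n := n) k'|%:R :> R by rewrite card_slice ltr0n bin_gt0.
have -> : high_overlap x k' l =
    [set v in slice k' | (m <= #|supp v :&: supp x|)%N]%SET.
  apply/setP => v; rewrite !inE; case: (_ == _) => //=; rewrite dotE.
  apply/idP/idP => [/mmin//|mv]; by rewrite (le_trans lm)// ler_nat.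
rewrite ler_pdivrMr//.
have := large_overlap_rare R n x k k' m xk k'0 k'n m0 (le_trans kl lm).
rewrite -ler_pdivlMr ?exprn_gt0// => /le_trans; apply.
rewrite mulrC ler_wpM2r ?(ltW S0)// -powR_mulrn// -powRN.
by apply: ler_powR; rewrite ?ler1n// lerN2.
Qed.

Section DepthProbability.
Context {R : realType} {n : nat} {x : 'cV[bool]_n}.
Context {d : measure_display} {T : measurableType d} {P : probability T R}.
Context {W : 'I_n -> 'I_n -> {RV P >-> R}}.

Lemma measurable_gibbs_set (M : T -> 'M[R]_n) k beta U :
  (forall i j, measurable_fun setT (fun w => M w i j)) ->
  measurable_fun setT (fun w => gibbs_set (M w) k beta U).
Proof.
move=> mM; rewrite /gibbs_set; under eq_fun do rewrite -big_enum.
by apply: measurable_sum => v; exact: measurable_gibbs.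
Qed.

(** Markov's inequality, with mean at most [2^-l] and threshold [2^(-l/2 - 1)], bounds the failure
    probability by [2^(1 - l/2)]. Otherwise [spike_bound] applies, and its error term costs at most
    half of the main term. *)
Lemma well_depth_ge (lambda beta l : R) k k' :
  is_GOE W -> 0 < lambda -> 0 <= beta -> norm0 x = k -> (0 < k')%N -> (k' <= n)%N ->
  0 < l -> 2 * expR 1 * k%:R * (k'%:R / n%:R) <= l ->
  4 * beta * lambda * l ^+ 2 / k%:R <= ln 2 / 4 * l ->
  ((1 - 2 `^ (- ((l - 2) / 2)))%:E <=
   P [set w | (ln 2 / 4 * l - ln 2)%:E <=
     well_depth (spiked lambda k x (random_mx W w)) x k' beta l]%classic)%E.
Proof.
move=> GOE lambda0 beta0 xk k'0 k'n l0 kl betal.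
have tail := high_overlap_mean_le R n x k k' l xk k'0 k'n l0 kl.
have S0 : 0 < #|slice (n := n) k'|%:R :> R by rewrite card_slice ltr0n bin_gt0.
have Sn0 : slice (n := n) k' != finset.set0 by rewrite -card_gt0 -(ltr0n R).
have mW i j : measurable_fun setT (fun w => random_mx W w i j).
  by under eq_fun do rewrite mxE; exact: measurable_funP.
have mY i j : measurable_fun setT (fun w => spiked lambda k x (random_mx W w) i j).
  rewrite /spiked; under eq_fun do rewrite mxE.
  by apply: measurable_funD => //; exact: measurable_cst.
pose f w := gibbs_set (random_mx W w) k' beta (high_overlap x k' l).
pose q : R := 2 `^ (- (l / 2) - 1).
have q0 : 0 < q by exact: powR_gt0.
have mean : (\int[P]_w (f w)%:E <= (2 `^ (- l))%:E)%E.
  rewrite (GOE_gibbs_set_mean R n d T P W)//.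
  by apply/fintype.subsetP => v; rewrite inE => /andP[].
(* If no vector had low overlap, the tail proportion would be [1], but it is at most [2^-l < 1].
   This keeps the first logarithm finite. *)
have low_gt0 M : 0 < gibbs_set M k' beta (low_overlap x k' l).
  have : [exists v, v \in low_overlap x k' l].
    apply: contraT; rewrite negb_exists => /forallP nlow.
    have HS : high_overlap x k' l = slice k'.
      apply/setP => v; have := nlow v; rewrite ![in X in X -> _]inE [in LHS]inE.
      rewrite dotE ler0n /= -dotE.
      rewrite [v \in slice _]inE; by case: (_ == k') => //=; rewrite -leNgt.
    move: tail; rewrite HS divff ?gt_eqF// leNgt => /negP[].
    by rewrite /powR pnatr_eq0/= expR_lt1 mulNr oppr_lt0 mulr_gt0// ln_gt0// ltr1n.
  case/existsP => v vlow; rewrite /gibbs_set (bigD1 v)//= ltr_pwDl//.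
    by rewrite divr_gt0 ?expR_gt0// partition_gt0.
  by apply: sumr_ge0 => u _; exact: gibbs_ge0.
have mf : measurable_fun setT f by exact: measurable_gibbs_set.
have := markov_le d T R P f q _ mf (fun w => gibbs_set_ge0 _ _ _ _ _ _) q0 mean.
rewrite (_ : 2 `^ (- l) / q = 2 `^ (- ((l - 2) / 2))); last first.
  rewrite /q -powRN -powRD; last by rewrite pnatr_eq0 implybT.
  by congr (_ `^ _); field.
move=> /le_trans; apply; apply: le_measure.
- rewrite inE -[X in measurable X]setTI.
  by apply: measurable_fun_le => //; exact: measurable_cst.
- rewrite inE.
  rewrite (_ : [set w | _]%classic = [set w | expR (ln 2 / 4 * l - ln 2) *
      gibbs_set (spiked lambda k x (random_mx W w)) k' beta (mid_overlap x k' l) <=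
      gibbs_set (spiked lambda k x (random_mx W w)) k' beta (low_overlap x k' l)]%classic).
    rewrite -[X in measurable X]setTI; apply: measurable_fun_le => //.
      apply: measurable_funM; first exact: measurable_cst.
      exact: measurable_gibbs_set.
    exact: measurable_gibbs_set.
  by apply/seteqP; split=> w /=; rewrite lne_diff_ge// gibbs_set_ge0.
- move=> w /= fq; rewrite lne_diff_ge ?gibbs_set_ge0//.
  apply: le_trans (spike_bound lambda0 beta0 _ (ltW l0) Sn0 fq).
  rewrite ler_wpM2r ?gibbs_set_ge0// ler_expR.
  have : 0 < ln 2 :> R by rewrite ln_gt0// ltr1n.
  move: betal; set c := _ / k%:R; lra.
Qed.

End DepthProbability.

(** * Choice of the correlation level *)

Theorem corollary3p9 (R : realType) (delta : R) (delta_gt0 : 0 < delta) :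
  exists n0 : nat,
  forall (n : nat) (lambda : R) (k k' : nat),
  (n0 <= n)%N ->
  0 < lambda ->
  (1 <= k <= n)%N ->
  (1 <= k')%N -> k'%:R <= n%:R `^ (1 - delta) ->
  forall (x : 'cV[bool]_n), norm0 x = k ->
  forall (d : measure_display) (T : measurableType d) (P : probability T R)
    (W : 'I_n -> 'I_n -> {RV P >-> R}), is_GOE W ->
  k%:R / lambda * Num.sqrt (k'%:R / n%:R) <= Num.min k%:R k'%:R ->
  lambda <= Num.min (n%:R `^ (- delta) * (k%:R / 2) * Num.sqrt (k'%:R / n%:R))
                    (1 / (4 * expR 1) * (n%:R / k'%:R) `^ (1 / 2 - delta)) ->
  forall beta : R,
  0 <= beta <= ln 2 / 16 * n%:R `^ (- delta) *
    Num.min (k%:R / lambda) (n%:R / (2 * expR 1 * lambda * k'%:R)) ->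
  exists l : R,
  [/\ Num.max (n%:R `^ delta)
        (2 * expR 1 * k%:R * (k'%:R / n%:R) `^ (1 - delta)) <= l,
      l <= k%:R / (2 * lambda) * Num.sqrt (k'%:R / n%:R),
      k%:R / (2 * lambda) * Num.sqrt (k'%:R / n%:R)
        <= 1 / 2 * Num.min k%:R k'%:R,
      ((1 - 2 `^ (- ((l - 2) / 2)))%:E <=
       P [set w | (ln 2 / 8)%:E *
                    mine ((ln 2 / 8)%:E *
                            (if beta == 0%R then +oo
                             else (k%:R / (beta * lambda))%:E))
                         (k%:R / lambda * Num.sqrt (k'%:R / n%:R))%:E
                  - (ln 2)%:E
                  <= well_depth (spiked lambda k x (random_mx W w))
                       x k' beta l]%classic)%E
    & 1 - 2 `^ (- ((n%:R `^ delta - 2) / 2))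
        <= 1 - 2 `^ (- ((l - 2) / 2)) :> R].
Proof.
(* The estimates hold for every [n >= 1], which [1 <= k <= n] ensures, so the witness is [0]. *)
exists 0%N => n lambda k k' _ lambda0 /andP[k1 kn] k'1 k'n x xk d T P W GOE rmin.
rewrite le_min => /andP[lam1 lam2] beta /andP[beta0 betale].
have n1 : (1 <= n)%N := leq_trans k1 kn.
have N1 : 1 <= n%:R :> R by rewrite ler1n.
have N0 : 0 < n%:R :> R by rewrite ltr0n.
have K0 : 0 < k%:R :> R by rewrite ltr0n.
have K'0 : 0 < k'%:R :> R by rewrite ltr0n.
have K'1 : 1 <= k'%:R :> R by rewrite ler1n.
have le_k'n : (k' <= n)%N.
  rewrite -(ler_nat R) (le_trans k'n)// -[leRHS]powRr1 ?ler0n//.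
  by apply: ler_powR => //; move: delta_gt0; lra.
set rho : R := k'%:R / n%:R.
have rho0 : 0 < rho by rewrite divr_gt0.
have rho1 : rho <= 1 by rewrite ler_pdivrMr// mul1r ler_nat.
set s := Num.sqrt rho.
have s0 : 0 < s by rewrite sqrtr_gt0.
have e0 : 0 < expR 1 :> R := expR_gt0 1.
have Nd0 : 0 < n%:R `^ delta by exact: powR_gt0.
have rd0 : 0 < rho `^ (1 - delta) by exact: powR_gt0.
have ln2 : 0 < ln 2 :> R by rewrite ln_gt0// ltr1n.
pose r : R := k%:R / (2 * lambda) * s.
have r0 : 0 < r by rewrite mulr_gt0// divr_gt0// mulr_gt0.
pose lmin := Num.max (n%:R `^ delta) (2 * expR 1 * k%:R * rho `^ (1 - delta)).
(* Each of the two bounds on [lambda] yields one of the two lower bounds on [r]; in the second, the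
   powers of [rho] combine to [rho^(1/2) = s]. *)
have lmin_r : lmin <= r.
  rewrite ge_max /r mulrAC !ler_pdivlMr ?mulr_gt0//; apply/andP; split.
    have : lambda * n%:R `^ delta <= k%:R / 2 * s.
      by rewrite -ler_pdivlMr// mulrC mulrA -powRN.
    lra.
  have E : rho `^ (1 - delta) * (n%:R / k'%:R) `^ (1 / 2 - delta) = s.
    have -> : n%:R / k'%:R = rho^-1 by rewrite /rho invf_div.
    rewrite -powR_inv1 ?ltW// -powRrM -powRD; last by rewrite (gt_eqF rho0) implybT.
    by rewrite /s -powR12_sqrt ?ltW//; congr (_ `^ _); field.
  have : 4 * expR 1 * k%:R * rho `^ (1 - delta) * lambda <= k%:R * s.
    apply: (@le_trans _ _ (4 * expR 1 * k%:R * rho `^ (1 - delta) *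
        (1 / (4 * expR 1) * (n%:R / k'%:R) `^ (1 / 2 - delta)))).
      by rewrite ler_wpM2l// !mulr_ge0// ltW.
    rewrite le_eqVlt -E; apply/orP; left; apply/eqP; field.
    by rewrite gt_eqF.
  lra.
(* The values of [l] up to [b] are those for which
   [4 beta lambda l^2 / k <= (ln 2 / 4) l]. *)
pose b : R := ln 2 / 16 * (k%:R / (beta * lambda)).
(* For [beta = 0] the quotient in [b] evaluates to [0] rather than to the intended [+oo], hence the
   case distinction. *)
pose l := if beta == 0 then r else Num.min b r.
have lr : l <= r by rewrite /l; case: ifP => // _; rewrite ge_min lexx orbT.
have lmin_l : lmin <= l.
  rewrite /l; case: eqP => // /eqP beta_neq0; rewrite le_min lmin_r andbT.
  have {}beta0 : 0 < beta by rewrite lt_def beta_neq0.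
  have bl0 : 0 < beta * lambda by rewrite mulr_gt0.
  have c0 : 0 <= ln 2 / 16 * n%:R `^ (- delta) by rewrite mulr_ge0 ?powR_ge0// divr_ge0// ltW.
  have b1 : beta <= ln 2 / 16 * n%:R `^ (- delta) * (k%:R / lambda).
    by rewrite (le_trans betale)// ler_wpM2l// ge_min lexx.
  have b2 : beta <= ln 2 / 16 * n%:R `^ (- delta) * (n%:R / (2 * expR 1 * lambda * k'%:R)).
    by rewrite (le_trans betale)// ler_wpM2l// ge_min lexx orbT.
  (* Common form of the two bounds on [beta], with [c = k] and with [c = n / (2 e k')]: each gives
     [b >= n^delta k / c]. *)
  have bE y c : 0 < c -> beta <= ln 2 / 16 * n%:R `^ (- delta) * (c / lambda) ->
      y * c <= n%:R `^ delta * k%:R -> y <= b.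
    move=> c_gt0 bc yc; rewrite /b mulrA ler_pdivlMr//.
    rewrite -(ler_pM2r c_gt0).
    apply: (@le_trans _ _ (n%:R `^ delta * k%:R * (beta * lambda))).
      by rewrite mulrAC ler_wpM2r// ltW.
    have : beta * lambda <= ln 2 / 16 * n%:R `^ (- delta) * c.
      by move: bc; rewrite mulrA ler_pdivlMr.
    have nk0 : 0 <= n%:R `^ delta * k%:R by rewrite mulr_ge0 ?ltW.
    move=> /(ler_wpM2l nk0)/le_trans; apply.
    rewrite le_eqVlt powRN; apply/orP; left; apply/eqP; field.
    by rewrite gt_eqF.
  rewrite ge_max; apply/andP; split; first exact: (bE _ k%:R).
  apply: (bE _ (n%:R / (2 * expR 1 * k'%:R))).
  - by rewrite divr_gt0// !mulr_gt0.
  - apply: (le_trans b2); rewrite le_eqVlt; apply/orP; left; apply/eqP; field.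
    by rewrite !gt_eqF.
  (* The claim becomes [rho^(-delta) <= n^delta], which holds because [1 / rho = n / k' <= n]. *)
  have -> : 2 * expR 1 * k%:R * rho `^ (1 - delta) * (n%:R / (2 * expR 1 * k'%:R)) =
      k%:R * (rho `^ (1 - delta) / rho).
    by rewrite /rho; field; rewrite !gt_eqF.
  rewrite mulrC ler_pM2r//.
  have -> : rho `^ (1 - delta) / rho = rho `^ (- delta).
    rewrite -[X in _ / X]powRr1 ?ltW// -powRN -powRD; last by rewrite (gt_eqF rho0) implybT.
    by congr (_ `^ _); ring.
  have -> : rho `^ (- delta) = rho^-1 `^ delta.
    by rewrite -powR_inv1 ?ltW// -powRrM mulN1r.
  have invrho : rho^-1 <= n%:R by rewrite /rho invf_div ler_pdivrMr// ler_peMr// ltW.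
  by apply: ge0_ler_powR => //; rewrite ?nnegrE ?invr_ge0 ltW.
have l0 : 0 < l by rewrite (lt_le_trans Nd0)// (le_trans _ lmin_l)// le_max lexx.
exists l; split => //.
- move: rmin; rewrite -/rho -/s; set m := Num.min _ _ => rmin.
  have -> : k%:R / (2 * lambda) * s = 1 / 2 * (k%:R / lambda * s).
    by field; rewrite gt_eqF.
  by rewrite ler_wpM2l.
(* The two arguments of the minimum are [2 b] and [2 r], so it equals [2 l]; for [beta = 0] the
   first is [+oo] and the minimum is [2 r]. *)
- have -> : ((ln 2 / 8)%:E *
      mine ((ln 2 / 8)%:E *
        (if beta == 0%R then +oo else (k%:R / (beta * lambda))%:E))
        (k%:R / lambda * Num.sqrt (k'%:R / n%:R))%:E - (ln 2)%:E =
      (ln 2 / 4 * l - ln 2)%:E)%E.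
    have aE : k%:R / lambda * Num.sqrt (k'%:R / n%:R) = 2 * r.
      by rewrite /r -/rho -/s; field; rewrite gt_eqF.
    rewrite aE /l; case: eqP => [_|_].
      rewrite gt0_muley ?lte_fin ?divr_gt0// minye -EFinM -EFinB.
      by congr _%:E; field.
    rewrite -EFinM -EFin_min -EFinM -EFinB; congr _%:E; congr (_ - _).
    have -> : ln 2 / 8 * (k%:R / (beta * lambda)) = 2 * b by rewrite /b; lra.
    by rewrite -minr_pMr//; lra.
  apply: well_depth_ge => //.
    (* As [rho <= 1], [rho <= rho^(1 - delta)], so this lower bound on [l] implies the tail
       condition. *)
    apply: le_trans lmin_l; rewrite le_max; apply/orP; right.
    apply: ler_wpM2l; first by rewrite !mulr_ge0// ltW.
    by apply: ger1_powR; [rewrite rho0|move: delta_gt0; lra].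
  rewrite ler_pdivrMr//.
  have [->|bn0] := eqVneq beta 0; first by rewrite mulr0 !mul0r !mulr_ge0 ?ltW.
  have {}beta0 : 0 < beta by rewrite lt_def bn0.
  have : l <= b by rewrite /l (negbTE bn0) ge_min lexx.
  rewrite /b mulrA ler_pdivlMr ?mulr_gt0// => /(ler_wpM2l (ltW l0)) H.
  move: H; rewrite expr2; lra.
- rewrite lerB// ler_powR ?ler1n//.
  have : n%:R `^ delta <= l by rewrite (le_trans _ lmin_l)// le_max lexx.
  lra.
Qed.
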